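(* Let $\Gamma=(V,E,s,t)$ be any multiquiver and $A=\mathcal{A}(\Gamma)$ the associated TGW algebra. Then the centralizer $C_A(R_E)=\{a\in A\mid ar=ra\ \forall r\in R_E\}$ is a maximal commutative subalgebra of $A$.
   Context: $\Bbbk$ is a field of characteristic zero; rings are associative and unital; $\mathbb{Z}X$ denotes the free abelian group on a set $X$. TGW algebras. A TGW datum $(R,\sigma,t)$ with index set $I$: a $\Bbbk$-algebra $R$, commuting $\Bbbk$-algebra automorphisms $\sigma=(\sigma_i)_{i\in I}$ of $R$, nonzero central elements $t=(t_i)_{i\in I}$ of $R$. Given $\mu=(\mu_{ij})_{i\ne j}$ with $\mu_{ij}\in\Bbbk\setminus\{0\}$, $\mathcal{C}_\mu(R,\sigma,t)$ is the free $R$-ring on symbols $X_i,Y_i$ ($i\in I$) modulo the relations $X_ir=\sigma_i(r)X_i$, $Y_ir=\sigma_i^{-1}(r)Y_i$, $Y_iX_i=t_i$, $X_iY_i=\sigma_i(t_i)$ ($r\in R$, $i\in I$), $X_iY_j=\mu_{ij}Y_jX_i$ ($i\neq j$). It is $\mathbb{Z}I$-graded by $\deg X_i=i$, $\deg Y_i=-i$, $\deg r=0$. The TGW algebra $\mathcal{A}_\mu(R,\sigma,t)$ is the quotient of $\mathcal{C}_\mu(R,\sigma,t)$ by the sum of all graded ideals having zero intersection with the degree-zero component. Multiquivers. A multiquiver $\Gamma=(V,E,s,t)$ consists of sets $V$, $E$ and functions $s,t:E\to (V\times\mathbb{Z}_{>0})\cup\{\emptyset\}$ such that (no loops) if $s(e)=(u,m)$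 and $t(e)=(v,n)$ then $u\ne v$; and (local finiteness) for each $v\in V$ only finitely many $e$ have $s(e)\in\{v\}\times\mathbb{Z}_{>0}$ or $t(e)\in\{v\}\times\mathbb{Z}_{>0}$. The incidence matrix $(\gamma_{ev})_{e\in E,v\in V}$ is given by $\gamma_{ev}=n$ if $t(e)=(v,n)$, $\gamma_{ev}=-n$ if $s(e)=(v,n)$, and $\gamma_{ev}=0$ otherwise. $\mathcal{A}(\Gamma)$ is the TGW algebra $\mathcal{A}_\mu(R_E,\sigma^\Gamma,t^\Gamma)$ with index set $V$, where all $\mu_{ij}=1$, $R_E=\Bbbk[u_e\mid e\in E]$ (polynomial algebra), $\sigma_v(u_e)=u_e-\gamma_{ev}$, $t_v=\prod_{e\in E}u_{ev}$ with $u_{ev}=u_e(u_e+1)\cdots(u_e+\gamma_{ev}-1)$ if $\gamma_{ev}>0$, $u_{ev}=1$ if $\gamma_{ev}=0$, $u_{ev}=(u_e-1)(u_e-2)\cdots(u_e-|\gamma_{ev}|)$ if $\gamma_{ev}<0$. The canonical map $R_E\to\mathcal{A}(\Gamma)$ is injective, and $R_E$ is identified with its image. *)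

(* Defs.v *)
From HB Require Import structures.
From mathcomp Require Import all_boot all_order all_algebra.
From mathcomp Require Import finmap all_classical.
From mathcomp.multinomials Require Import monalg.

Set Implicit Arguments.
Unset Strict Implicit.
Unset Printing Implicit Defensive.

Import GRing.Theory.

Local Open Scope classical_set_scope.
Local Open Scope quotient_scope.
Local Open Scope ring_scope.

Record ideal (T : pzRingType) := Ideal {
  ideal_set :> T -> Prop;
  ideal0 : ideal_set 0;
  idealB : forall x y, ideal_set x -> ideal_set y -> ideal_set (x - y);
  idealMl : forall a x, ideal_set x -> ideal_set (a * x);
  idealMr : forall a x, ideal_set x -> ideal_set (x * a) }.

Section IdealTheory.
Variable T : pzRingType.
Implicit Types (J : ideal T) (S : set T) (P : set (ideal T)).

Lemma idealN J x : J x -> J (- x).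
Proof. by move=> Jx; rewrite -sub0r; apply: idealB => //; apply: ideal0. Qed.

Lemma idealD J x y : J x -> J y -> J (x + y).
Proof. by move=> Jx Jy; rewrite -[y]opprK; apply: idealB => //; apply: idealN. Qed.

Definition ideal_gen_set S : set T :=
  [set x | forall J, S `<=` J -> J x].

Program Definition ideal_gen S : ideal T := @Ideal T (ideal_gen_set S) _ _ _ _.
Next Obligation. by move=> S J _; apply: ideal0. Qed.
Next Obligation. by move=> S x y Sx Sy J SJ; apply: idealB; auto. Qed.
Next Obligation. by move=> S a x Sx J SJ; apply: idealMl; auto. Qed.
Next Obligation. by move=> S a x Sx J SJ; apply: idealMr; auto. Qed.

Lemma ideal_gen_sub S x : S x -> ideal_gen S x.
Proof. by move=> Sx J; apply. Qed.

Definition ideal_sum_set P : set T :=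
  [set x | exists2 s : seq T,
     {in s, forall y, exists2 J, P J & J y} & x = \sum_(y <- s) y].

Program Definition ideal_sum P : ideal T := @Ideal T (ideal_sum_set P) _ _ _ _.
Next Obligation. by move=> P; exists [::] => //; rewrite big_nil. Qed.
Next Obligation.
move=> P _ _ [s Ps ->] [s' Ps' ->]; exists (s ++ [seq - y | y <- s']).
  move=> y; rewrite mem_cat => /orP[/Ps//|/mapP[z /Ps'[J PJ Jz] ->]].
  by exists J => //; apply: idealN.
by rewrite big_cat big_map sumrN.
Qed.
Next Obligation.
move=> P a _ [s Ps ->]; exists [seq a * y | y <- s].
  by move=> _ /mapP[z /Ps[J PJ Jz] ->]; exists J => //; apply: idealMl.
by rewrite big_map mulr_sumr.
Qed.
Next Obligation.
move=> P a _ [s Ps ->]; exists [seq y * a | y <- s].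
  by move=> _ /mapP[z /Ps[J PJ Jz] ->]; exists J => //; apply: idealMr.
by rewrite big_map mulr_suml.
Qed.

End IdealTheory.

Section IdealQuotient.
Variables (T : pzRingType) (J : ideal T).

Definition eqmod : rel T := fun x y => `[< J (x - y) >].

Lemma eqmod_refl : reflexive eqmod.
Proof. by move=> x; apply/asboolP; rewrite subrr; apply: ideal0. Qed.

Lemma eqmod_sym : symmetric eqmod.
Proof.
suff sym x y : eqmod x y -> eqmod y x by move=> x y; apply/idP/idP; apply: sym.
by move=> /asboolP Jxy; apply/asboolP; rewrite -opprB; apply: idealN.
Qed.

Lemma eqmod_trans : transitive eqmod.
Proof.
move=> y x z /asboolP Jxy /asboolP Jyz; apply/asboolP.
by rewrite -(subrK y x) -addrA; apply: idealD.
Qed.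

Canonical eqmod_equiv := EquivRel eqmod eqmod_refl eqmod_sym eqmod_trans.

Definition quot := {eq_quot eqmod}.

HB.instance Definition _ := Choice.on quot.
HB.instance Definition _ := EqQuotient.on quot.

Definition quot_proj (x : T) : quot := \pi x.

Lemma quot_projP x y : quot_proj x = quot_proj y <-> J (x - y).
Proof.
by split => [/eqP|Jxy]; [rewrite piE => /asboolP|apply/eqP; rewrite piE; apply/asboolP].
Qed.

Lemma quot_projK : cancel (repr : quot -> T) quot_proj.
Proof. exact: reprK. Qed.

Lemma quotW (P : quot -> Prop) : (forall x, P (quot_proj x)) -> forall q, P q.
Proof. by move=> Px q; rewrite -[q]quot_projK. Qed.

Lemma repr_projP x : J (repr (quot_proj x) - x).
Proof. by apply/quot_projP; rewrite quot_projK. Qed.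

Definition quot_add (p q : quot) := quot_proj (repr p + repr q).
Definition quot_opp (p : quot) := quot_proj (- repr p).
Definition quot_mul (p q : quot) := quot_proj (repr p * repr q).

Lemma quot_addE x y : quot_add (quot_proj x) (quot_proj y) = quot_proj (x + y).
Proof. by apply/quot_projP; rewrite opprD addrACA; apply: idealD; apply: repr_projP. Qed.

Lemma quot_oppE x : quot_opp (quot_proj x) = quot_proj (- x).
Proof. by apply/quot_projP; rewrite -opprD; apply/idealN/repr_projP. Qed.

Lemma quot_mulE x y : quot_mul (quot_proj x) (quot_proj y) = quot_proj (x * y).
Proof.
apply/quot_projP; set x' := repr _; set y' := repr _.
have -> : x' * y' - x * y = x' * (y' - y) + (x' - x) * y.
  by rewrite mulrBr mulrBl addrA subrK.
by apply: idealD; [apply: idealMl|apply: idealMr]; apply: repr_projP.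
Qed.

Let quotE := (quot_addE, quot_oppE, quot_mulE).

Lemma quot_addA : associative quot_add.
Proof. by do 3![apply: quotW => ?]; rewrite !quotE addrA. Qed.
Lemma quot_addC : commutative quot_add.
Proof. by do 2![apply: quotW => ?]; rewrite !quotE addrC. Qed.
Lemma quot_add0 : left_id (quot_proj 0) quot_add.
Proof. by apply: quotW => ?; rewrite !quotE add0r. Qed.
Lemma quot_addN : left_inverse (quot_proj 0) quot_opp quot_add.
Proof. by apply: quotW => ?; rewrite !quotE addNr. Qed.
Lemma quot_mulA : associative quot_mul.
Proof. by do 3![apply: quotW => ?]; rewrite !quotE mulrA. Qed.
Lemma quot_mul1 : left_id (quot_proj 1) quot_mul.
Proof. by apply: quotW => ?; rewrite !quotE mul1r. Qed.
Lemma quot_mulr1 : right_id (quot_proj 1) quot_mul.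
Proof. by apply: quotW => ?; rewrite !quotE mulr1. Qed.
Lemma quot_mulDl : left_distributive quot_mul quot_add.
Proof. by do 3![apply: quotW => ?]; rewrite !quotE mulrDl. Qed.
Lemma quot_mulDr : right_distributive quot_mul quot_add.
Proof. by do 3![apply: quotW => ?]; rewrite !quotE mulrDr. Qed.

HB.instance Definition _ := GRing.isZmodule.Build quot
  quot_addA quot_addC quot_add0 quot_addN.
HB.instance Definition _ := GRing.Zmodule_isPzRing.Build quot
  quot_mulA quot_mul1 quot_mulr1 quot_mulDl quot_mulDr.

Lemma quot_proj_is_zmod_morphism : zmod_morphism quot_proj.
Proof. by move=> x y; rewrite -quot_addE -quot_oppE. Qed.
Lemma quot_proj_is_monoid_morphism : monoid_morphism quot_proj.
Proof. by split => // x y; rewrite -quot_mulE. Qed.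

HB.instance Definition _ := GRing.isZmodMorphism.Build T quot quot_proj
  quot_proj_is_zmod_morphism.
HB.instance Definition _ := GRing.isMonoidMorphism.Build T quot quot_proj
  quot_proj_is_monoid_morphism.

End IdealQuotient.

Inductive rterm (R G : Type) :=
| RCst of R
| RGen of G
| RAdd of rterm R G & rterm R G
| ROpp of rterm R G
| RMul of rterm R G & rterm R G.
Arguments RCst {R G}.
Arguments RGen {R G}.

HB.instance Definition _ (R G : Type) := gen_eqMixin (rterm R G).
HB.instance Definition _ (R G : Type) := gen_choiceMixin (rterm R G).

Section FreeRing.
Variables (R : pzRingType) (G : Type).
Local Notation term := (rterm R G).

(* The least congruence making terms a ring and RCst a ring morphism. *)
Inductive req : term -> term -> Prop :=
| req_refl a : req a a
| req_sym a b : req a b -> req b a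
| req_trans b a c : req a b -> req b c -> req a c
| req_add a a' b b' : req a a' -> req b b' -> req (RAdd a b) (RAdd a' b')
| req_opp a a' : req a a' -> req (ROpp a) (ROpp a')
| req_mul a a' b b' : req a a' -> req b b' -> req (RMul a b) (RMul a' b')
| req_addA a b c : req (RAdd a (RAdd b c)) (RAdd (RAdd a b) c)
| req_addC a b : req (RAdd a b) (RAdd b a)
| req_add0 a : req (RAdd (RCst 0) a) a
| req_addN a : req (RAdd (ROpp a) a) (RCst 0)
| req_mulA a b c : req (RMul a (RMul b c)) (RMul (RMul a b) c)
| req_mul1 a : req (RMul (RCst 1) a) a
| req_mulr1 a : req (RMul a (RCst 1)) a
| req_mulDl a b c : req (RMul (RAdd a b) c) (RAdd (RMul a c) (RMul b c))
| req_mulDr a b c : req (RMul a (RAdd b c)) (RAdd (RMul a b) (RMul a c))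
| req_cstD r s : req (RCst (r + s)) (RAdd (RCst r) (RCst s))
| req_cstM r s : req (RCst (r * s)) (RMul (RCst r) (RCst s)).

Definition reqb : rel term := fun a b => `[< req a b >].

Lemma reqb_refl : reflexive reqb.
Proof. by move=> a; apply/asboolP/req_refl. Qed.
Lemma reqb_sym : symmetric reqb.
Proof. by move=> a b; apply/asboolP/asboolP; apply: req_sym. Qed.
Lemma reqb_trans : transitive reqb.
Proof. by move=> b a c /asboolP ab /asboolP bc; apply/asboolP/(req_trans ab bc). Qed.

Canonical reqb_equiv := EquivRel reqb reqb_refl reqb_sym reqb_trans.

Definition freeRing := {eq_quot reqb}.

HB.instance Definition _ := Choice.on freeRing.
HB.instance Definition _ := EqQuotient.on freeRing.

Definition free_class (a : term) : freeRing := \pi a.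

Lemma free_classP a b : free_class a = free_class b <-> req a b.
Proof.
by split => [/eqP|ab]; [rewrite piE => /asboolP|apply/eqP; rewrite piE; apply/asboolP].
Qed.

Lemma free_classK : cancel (repr : freeRing -> term) free_class.
Proof. exact: reprK. Qed.

Lemma freeW (P : freeRing -> Prop) : (forall a, P (free_class a)) -> forall x, P x.
Proof. by move=> Pa x; rewrite -[x]free_classK. Qed.

Lemma repr_freeP a : req (repr (free_class a)) a.
Proof. by apply/free_classP; rewrite free_classK. Qed.

Definition free_add (x y : freeRing) := free_class (RAdd (repr x) (repr y)).
Definition free_opp (x : freeRing) := free_class (ROpp (repr x)).
Definition free_mul (x y : freeRing) := free_class (RMul (repr x) (repr y)).

Lemma free_addE a b : free_add (free_class a) (free_class b) = free_class (RAdd a b).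
Proof. by apply/free_classP/req_add; apply: repr_freeP. Qed.
Lemma free_oppE a : free_opp (free_class a) = free_class (ROpp a).
Proof. by apply/free_classP/req_opp; apply: repr_freeP. Qed.
Lemma free_mulE a b : free_mul (free_class a) (free_class b) = free_class (RMul a b).
Proof. by apply/free_classP/req_mul; apply: repr_freeP. Qed.

Let freeE := (free_addE, free_oppE, free_mulE).

Lemma free_addA : associative free_add.
Proof. by do 3![apply: freeW => ?]; rewrite !freeE; apply/free_classP/req_addA. Qed.
Lemma free_addC : commutative free_add.
Proof. by do 2![apply: freeW => ?]; rewrite !freeE; apply/free_classP/req_addC. Qed.
Lemma free_add0 : left_id (free_class (RCst 0)) free_add.
Proof. by apply: freeW => ?; rewrite !freeE; apply/free_classP/req_add0. Qed.
Lemma free_addN : left_inverse (free_class (RCst 0)) free_opp free_add.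
Proof. by apply: freeW => ?; rewrite !freeE; apply/free_classP/req_addN. Qed.
Lemma free_mulA : associative free_mul.
Proof. by do 3![apply: freeW => ?]; rewrite !freeE; apply/free_classP/req_mulA. Qed.
Lemma free_mul1 : left_id (free_class (RCst 1)) free_mul.
Proof. by apply: freeW => ?; rewrite !freeE; apply/free_classP/req_mul1. Qed.
Lemma free_mulr1 : right_id (free_class (RCst 1)) free_mul.
Proof. by apply: freeW => ?; rewrite !freeE; apply/free_classP/req_mulr1. Qed.
Lemma free_mulDl : left_distributive free_mul free_add.
Proof. by do 3![apply: freeW => ?]; rewrite !freeE; apply/free_classP/req_mulDl. Qed.
Lemma free_mulDr : right_distributive free_mul free_add.
Proof. by do 3![apply: freeW => ?]; rewrite !freeE; apply/free_classP/req_mulDr. Qed.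

HB.instance Definition _ := GRing.isZmodule.Build freeRing
  free_addA free_addC free_add0 free_addN.
HB.instance Definition _ := GRing.Zmodule_isPzRing.Build freeRing
  free_mulA free_mul1 free_mulr1 free_mulDl free_mulDr.

Definition free_cst (r : R) : freeRing := free_class (RCst r).
Definition free_gen (g : G) : freeRing := free_class (RGen g).

Lemma free_cstD : {morph free_cst : r s / r + s}.
Proof. by move=> r s; rewrite [RHS]free_addE; apply/free_classP/req_cstD. Qed.

Lemma free_cst_is_zmod_morphism : zmod_morphism free_cst.
Proof. by move=> r s; apply/(addIr (free_cst s)); rewrite -free_cstD !subrK. Qed.
Lemma free_cst_is_monoid_morphism : monoid_morphism free_cst.
Proof.
by split => // r s; rewrite [RHS]free_mulE; apply/free_classP/req_cstM.
Qed.

HB.instance Definition _ := GRing.isZmodMorphism.Build R freeRing free_cst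
  free_cst_is_zmod_morphism.
HB.instance Definition _ := GRing.isMonoidMorphism.Build R freeRing free_cst
  free_cst_is_monoid_morphism.

Lemma freeRing_ind (P : freeRing -> Prop) :
    (forall r, P (free_cst r)) -> (forall g, P (free_gen g)) ->
    (forall x y, P x -> P y -> P (x + y)) -> (forall x, P x -> P (- x)) ->
    (forall x y, P x -> P y -> P (x * y)) ->
  forall x, P x.
Proof.
move=> Pc Pg PD PN PM; apply: freeW; elim => [r|g|a Pa b Pb|a Pa|a Pa b Pb].
- exact: Pc.
- exact: Pg.
- by rewrite -free_addE; apply: PD.
- by rewrite -free_oppE; apply: PN.
- by rewrite -free_mulE; apply: PM.
Qed.

End FreeRing.

Record tgw_datum (k : fieldType) (I : choiceType) := TGWDatum {
  tgw_R : algType k;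
  tgw_sigma : I -> {lrmorphism tgw_R -> tgw_R};
  tgw_sigmaV : I -> tgw_R -> tgw_R;
  tgw_sigmaK : forall i, cancel (tgw_sigma i) (tgw_sigmaV i);
  tgw_sigmaVK : forall i, cancel (tgw_sigmaV i) (tgw_sigma i);
  tgw_sigmaC : forall i j r,
    tgw_sigma i (tgw_sigma j r) = tgw_sigma j (tgw_sigma i r);
  tgw_t : I -> tgw_R;
  tgw_t_neq0 : forall i, tgw_t i != 0;
  tgw_t_central : forall i r, tgw_t i * r = r * tgw_t i }.

(* The diagonal entries are never used. *)
Record tgw_mu (k : fieldType) (I : choiceType) := TGWMu {
  mu_val :> I -> I -> k;
  mu_neq0 : forall i j, i != j -> mu_val i j != 0 }.

Variant tgw_gen (I : Type) := GenX of I | GenY of I.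

Section TGWAlgebra.
Variables (k : fieldType) (I : choiceType) (D : tgw_datum k I) (mu : tgw_mu k I).
Local Notation R := (tgw_R D).
Local Notation sigma := (tgw_sigma D).
Local Notation sigmaV := (@tgw_sigmaV _ _ D).
Local Notation t := (tgw_t D).
Local Notation F := (freeRing R (tgw_gen I)).
Local Notation c := (@free_cst R (tgw_gen I)).
Local Notation X i := (@free_gen R (tgw_gen I) (GenX i)).
Local Notation Y i := (@free_gen R (tgw_gen I) (GenY i)).

Variant tgw_rel : F -> Prop :=
| tgw_rel_Xr i r : tgw_rel (X i * c r - c (sigma i r) * X i)
| tgw_rel_Yr i r : tgw_rel (Y i * c r - c (sigmaV i r) * Y i)
| tgw_rel_YX i : tgw_rel (Y i * X i - c (t i))
| tgw_rel_XY i : tgw_rel (X i * Y i - c (sigma i (t i)))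
| tgw_rel_mu i j of i != j :
    tgw_rel (X i * Y j - c ((mu i j)%:A) * (Y j * X i)).

Definition tgwC := quot (ideal_gen tgw_rel).
HB.instance Definition _ := GRing.PzRing.on tgwC.

Definition tgwC_proj : {rmorphism F -> tgwC} := @quot_proj F (ideal_gen tgw_rel).
Definition tgwC_cst (r : R) : tgwC := tgwC_proj (c r).
Definition tgwC_X (i : I) : tgwC := tgwC_proj (X i).
Definition tgwC_Y (i : I) : tgwC := tgwC_proj (Y i).

(* [tgw_homog d] is the component of degree d: the additive span of the
   products of elements of R and generators X_i, Y_i of total degree d.
   The group of degrees ZI is {malg int[I]}, with basis elements << i >>. *)
Inductive tgw_homog : {malg int[I]} -> tgwC -> Prop :=
| homog_cst r : tgw_homog 0 (tgwC_cst r)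
| homog_X i : tgw_homog << i >> (tgwC_X i)
| homog_Y i : tgw_homog (- << i >>) (tgwC_Y i)
| homog_zero d : tgw_homog d 0
| homog_sub d x y : tgw_homog d x -> tgw_homog d y -> tgw_homog d (x - y)
| homog_mul d d' x y :
    tgw_homog d x -> tgw_homog d' y -> tgw_homog (d + d') (x * y).

Definition graded_ideal (J : ideal tgwC) : Prop :=
  forall x, J x -> exists2 s : seq tgwC,
    {in s, forall y, J y /\ exists d, tgw_homog d y} & x = \sum_(y <- s) y.

Definition zero_meets_degree0 (J : ideal tgwC) : Prop :=
  forall x, J x -> tgw_homog 0 x -> x = 0.

Definition tgw_radical : ideal tgwC :=
  ideal_sum [set J | graded_ideal J /\ zero_meets_degree0 J].

Definition tgwA := quot tgw_radical.
HB.instance Definition _ := GRing.PzRing.on tgwA.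

Definition tgwA_proj : {rmorphism tgwC -> tgwA} := @quot_proj tgwC tgw_radical.
Definition tgwA_cst (r : R) : tgwA := tgwA_proj (tgwC_cst r).

Lemma tgwA_cst_is_zmod_morphism : zmod_morphism tgwA_cst.
Proof. by move=> r s; rewrite /tgwA_cst /tgwC_cst !rmorphB. Qed.
Lemma tgwA_cst_is_monoid_morphism : monoid_morphism tgwA_cst.
Proof.
by split => [|r s]; rewrite /tgwA_cst /tgwC_cst ?rmorph1 // !rmorphM.
Qed.

HB.instance Definition _ := GRing.isZmodMorphism.Build R tgwA tgwA_cst
  tgwA_cst_is_zmod_morphism.
HB.instance Definition _ := GRing.isMonoidMorphism.Build R tgwA tgwA_cst
  tgwA_cst_is_monoid_morphism.

(* The k-algebra structure of A. It is given as lmodType plus pzRingType, since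
   algType would require 1 != 0; [tgw_scaleAl] and [tgw_scaleAr] below are the
   remaining algebra axioms. *)
Definition tgw_scale (a : k) (x : tgwA) : tgwA := tgwA_cst a%:A * x.

Lemma tgw_scaleA a b x : tgw_scale a (tgw_scale b x) = tgw_scale (a * b) x.
Proof. by rewrite /tgw_scale mulrA -rmorphM -scalerAl mul1r scalerA. Qed.
Lemma tgw_scale1 : left_id 1 tgw_scale.
Proof. by move=> x; rewrite /tgw_scale scale1r rmorph1 mul1r. Qed.
Lemma tgw_scaleDr : right_distributive tgw_scale +%R.
Proof. by move=> a x y; rewrite /tgw_scale mulrDr. Qed.
Lemma tgw_scaleDl x : {morph tgw_scale^~ x : a b / a + b}.
Proof. by move=> a b; rewrite /tgw_scale scalerDl rmorphD mulrDl. Qed.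

HB.instance Definition _ := GRing.Zmodule_isLmodule.Build k tgwA
  tgw_scaleA tgw_scale1 tgw_scaleDr tgw_scaleDl.

Lemma tgw_scaleAl (a : k) (x y : tgwA) : a *: (x * y) = (a *: x) * y.
Proof. exact: mulrA. Qed.

Lemma tgwC_cst_scalar_central (a : k) (x : F) :
  tgwC_proj x * tgwC_cst a%:A = tgwC_cst a%:A * tgwC_proj x.
Proof.
elim/freeRing_ind: x => [r|g|x y Hx Hy|x Hx|x y Hx Hy].
- by rewrite -!rmorphM /= -scalerAl -scalerAr mul1r mulr1.
- rewrite /tgwC_cst -!rmorphM; apply/quot_projP/ideal_gen_sub; case: g => i.
    by have := tgw_rel_Xr i a%:A; rewrite linearZ /= rmorph1.
  have := tgw_rel_Yr i a%:A; suff -> : sigmaV i a%:A = a%:A by [].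
  by rewrite -[RHS](@tgw_sigmaK _ _ D i) linearZ /= rmorph1.
- by rewrite !rmorphD mulrDl mulrDr Hx Hy.
- by rewrite !rmorphN mulNr mulrN Hx.
- by rewrite !rmorphM -mulrA Hy mulrA Hx mulrA.
Qed.

Lemma tgwA_cst_scalar_central (a : k) (x : tgwA) :
  x * tgwA_cst a%:A = tgwA_cst a%:A * x.
Proof.
move: x; apply: quotW => x; rewrite -[quot_proj _ x]/(tgwA_proj x).
rewrite /tgwA_cst -!rmorphM; congr (tgwA_proj _).
by move: x; apply: quotW => x; apply: tgwC_cst_scalar_central.
Qed.

Lemma tgw_scaleAr (a : k) (x y : tgwA) : a *: (x * y) = x * (a *: y).
Proof. by rewrite [LHS]mulrA -tgwA_cst_scalar_central -mulrA. Qed.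

Definition is_subalgebra (B : set tgwA) : Prop :=
  [/\ B 1,
      forall (a : k) x, B x -> B (a *: x),
      forall x y, B x -> B y -> B (x + y) &
      forall x y, B x -> B y -> B (x * y)].

Definition is_commutative (B : set tgwA) : Prop :=
  forall x y, B x -> B y -> x * y = y * x.

Definition maximal_commutative_subalgebra (B : set tgwA) : Prop :=
  [/\ is_subalgebra B, is_commutative B &
      forall B' : set tgwA, is_subalgebra B' -> is_commutative B' ->
        B `<=` B' -> B' = B].

Definition tgw_centralizer : set tgwA :=
  [set a | forall r : R, a * tgwA_cst r = tgwA_cst r * a].

End TGWAlgebra.

Arguments tgw_centralizer {k I} D mu.

Notation polyE k E := {malg k[{cmonom E}]}.

Section Poly.
Variables (k : fieldType) (E : choiceType).

Definition uvar (e : E) : polyE k E := << ucm e >>.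

Variable S : comAlgType k.
Implicit Type h : E -> S.

Definition cmsubst h (m : {cmonom E}) : S := \prod_(e <- finsupp m) h e ^+ m e.

Lemma cmsubstEw h (m : {cmonom E}) (d : {fset E}) : (finsupp m `<=` d)%fset ->
  cmsubst h m = \prod_(e <- d) h e ^+ m e.
Proof.
move=> le; rewrite /cmsubst (big_fset_incl _ le) //= => e _.
by rewrite -cmE_eq0 => /eqP ->; rewrite expr0.
Qed.

Lemma cmsubst_is_mmorphism h : mmorphism (cmsubst h).
Proof.
split=> [m1 m2|]; last by rewrite /cmsubst mdom1 big_seq_fset0.
rewrite {1}/cmsubst mdomD (cmsubstEw h (fsubsetUl _ (finsupp m2))).
rewrite (cmsubstEw h (fsubsetUr (finsupp m1) _)) -big_split /=.
by apply: eq_bigr => e _; rewrite cmM exprD.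
Qed.

HB.instance Definition _ h := isMultiplicative.Build _ _ (cmsubst h)
  (cmsubst_is_mmorphism h).

End Poly.

(* The k-algebra morphism sending u_e to h e. *)
HB.lock Definition usubst (k : fieldType) (E : choiceType) (S : comAlgType k)
    (h : E -> S) (p : polyE k E) : S :=
  mmap (GRing.in_alg S) (cmsubst h) p.

Section PolySubst.
Variables (k : fieldType) (E : choiceType) (S : comAlgType k).
Implicit Type h : E -> S.

Lemma usubst_is_zmod_morphism h : zmod_morphism (usubst h).
Proof. by move=> p q; rewrite usubst.unlock rmorphB. Qed.
Lemma usubst_is_monoid_morphism h : monoid_morphism (usubst h).
Proof. by split => [|p q]; rewrite usubst.unlock ?rmorph1 ?rmorphM. Qed.
Lemma usubst_is_scalable h : scalable (usubst h).
Proof. by move=> a p; rewrite usubst.unlock mmapZ /= -scalerAl mul1r. Qed.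

HB.instance Definition _ h := GRing.isZmodMorphism.Build (polyE k E) S (usubst h)
  (usubst_is_zmod_morphism h).
HB.instance Definition _ h := GRing.isMonoidMorphism.Build (polyE k E) S (usubst h)
  (usubst_is_monoid_morphism h).
HB.instance Definition _ h := GRing.isScalable.Build k (polyE k E) S *:%R (usubst h)
  (usubst_is_scalable h).

Lemma usubst_uvar h e : usubst h (uvar k e) = h e.
Proof. by rewrite usubst.unlock mmapU /= scale1r mul1r /cmsubst mdomU big_seq_fset1 cmUU. Qed.

End PolySubst.

Lemma lrmorph_polyE_ext (k : fieldType) (E : choiceType) (S : comAlgType k)
    (f g : {lrmorphism polyE k E -> S}) :
  (forall e, f (uvar k e) = g (uvar k e)) -> f =1 g.
Proof.
move=> fg.
have fgX m : f << m >> = g << m >>.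
  have [n] := ubnP (mdeg m); elim: n m => // n IHn m; rewrite ltnS => mn.
  have [->|] := eqVneq m mone; first by rewrite (rmorph1 f) (rmorph1 g).
  rewrite -mdeg_eq0 => m0.
  have [e em] : exists e, e \in finsupp m.
    have [m_eq0|[e em]] := fset_0Vmem (finsupp m); last by exists e.
    by move: m0; rewrite mdegE m_eq0 big_seq_fset0.
  have defm : m = mmul (ucm e) (divcm m (ucm e)).
    apply/eqP/cmP => i; rewrite cmM divcmE cmU subnKC //.
    by case: eqVneq => [<-|//]; rewrite lt0n cmE_neq0.
  have -> : << m >> = uvar k e * << divcm m (ucm e) >> :> polyE k E.
    by rewrite {1}defm -[1 in LHS](mulr1 1) -fgmulUU.
  rewrite (rmorphM f) (rmorphM g); congr (_ * _); first exact: fg.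
  apply: IHn; apply: leq_trans mn.
  by rewrite [in X in (_ < X)%N]defm mdegM mdegU.
move=> p; rewrite [p]monalgE (raddf_sum f) (raddf_sum g); apply: eq_bigr => m _.
have -> : << p@_m *g m >> = p@_m *: << m >> :> polyE k E.
  by rewrite -mul_malgC malgM_def fgmulUU mul1m mulr1.
exact: etrans (linearZZ f _ _) (etrans (congr1 _ (fgX m)) (esym (linearZZ g _ _))).
Qed.

(* None stands for the empty symbol; Some (v, n) for the pair (v, n), n > 0. *)
Record multiquiver (V E : choiceType) := Multiquiver {
  mq_s : E -> option (V * nat);
  mq_t : E -> option (V * nat);
  mq_s_gt0 : forall e v n, mq_s e = Some (v, n) -> (0 < n)%N;
  mq_t_gt0 : forall e v n, mq_t e = Some (v, n) -> (0 < n)%N;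
  mq_noloop : forall e u m v n,
    mq_s e = Some (u, m) -> mq_t e = Some (v, n) -> u <> v;
  mq_locfin : forall v, finite_set
    [set e | (exists n, mq_s e = Some (v, n)) \/ (exists n, mq_t e = Some (v, n))] }.

Section MultiquiverAlgebra.
Variables (k : fieldType) (V E : choiceType) (Gamma : multiquiver V E).
Local Notation RE := (polyE k E).

Definition mult_at (o : option (V * nat)) (v : V) : option nat :=
  if o is Some (w, n) then (if w == v then Some n else None) else None.

Definition incidence (e : E) (v : V) : int :=
  match mult_at (mq_t Gamma e) v, mult_at (mq_s Gamma e) v with
  | Some n, _ => n%:Z
  | None, Some n => - n%:Z
  | None, None => 0
  end.

Lemma incidence_finite v : finite_set [set e | incidence e v != 0].
Proof.
apply: sub_finite_set (mq_locfin Gamma v) => e /=; rewrite /incidence /mult_at.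
case: (mq_t Gamma e) => [[w n]|].
  have [->|_] := eqVneq w v; first by right; exists n.
  case: (mq_s Gamma e) => [[w' n']|]; last by rewrite eqxx.
  by have [-> _|_] := eqVneq w' v; [left; exists n'|rewrite eqxx].
case: (mq_s Gamma e) => [[w n]|]; last by rewrite eqxx.
by have [-> _|_] := eqVneq w v; [left; exists n|rewrite eqxx].
Qed.

Definition mq_sigma (v : V) : {lrmorphism RE -> RE} :=
  usubst (fun e => uvar k e - (incidence e v)%:~R).

Definition mq_sigmaV (v : V) : {lrmorphism RE -> RE} :=
  usubst (fun e => uvar k e + (incidence e v)%:~R).

Definition mq_factor (e : E) (v : V) : RE :=
  match incidence e v with
  | Posz n => \prod_(0 <= i < n) (uvar k e + i%:R)
  | Negz n => \prod_(1 <= i < n.+2) (uvar k e - i%:R) (* Negz n = - n.+1 *)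
  end.

(* All but finitely many factors are 1, by [incidence_finite]. *)
Definition mq_tgw_t (v : V) : RE := \big[*%R/1]_(e \in [set: E]) mq_factor e v.

Lemma mq_sigmaK v : cancel (mq_sigma v) (mq_sigmaV v).
Proof.
apply: (lrmorph_polyE_ext (f := mq_sigmaV v \o mq_sigma v) (g := idfun)) => e /=.
by rewrite usubst_uvar rmorphB rmorph_int /= usubst_uvar addrK.
Qed.

Lemma mq_sigmaVK v : cancel (mq_sigmaV v) (mq_sigma v).
Proof.
apply: (lrmorph_polyE_ext (f := mq_sigma v \o mq_sigmaV v) (g := idfun)) => e /=.
by rewrite usubst_uvar rmorphD rmorph_int /= usubst_uvar subrK.
Qed.

Lemma mq_sigmaC v w p : mq_sigma v (mq_sigma w p) = mq_sigma w (mq_sigma v p).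
Proof.
pose f : {lrmorphism RE -> RE} := mq_sigma v \o mq_sigma w.
pose g : {lrmorphism RE -> RE} := mq_sigma w \o mq_sigma v.
suff fg : f =1 g by exact: fg.
apply: lrmorph_polyE_ext => e; rewrite /f /g /=.
by rewrite !usubst_uvar !rmorphB !rmorph_int /= !usubst_uvar addrAC.
Qed.

Lemma mq_tgw_t_neq0 v : mq_tgw_t v != 0.
Proof.
pose f := @usubst k E {poly k} (fun=> 'X).
suff : f (mq_tgw_t v) != 0 by apply: contra_neq => ->; rewrite /f rmorph0.
have fP (T : Type) (s : seq T) (P : pred T) (F : T -> RE) :
    (forall i, f (F i) != 0) -> f (\prod_(i <- s | P i) F i) != 0.
  move=> F0; apply: (big_ind (fun p => f p != 0)) => [|p q fp fq|i _].
  - by rewrite /f rmorph1 oner_eq0.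
  - by rewrite /f rmorphM mulf_neq0.
  - exact: F0.
have XP (c : k) : 'X + c%:P != 0 :> {poly k}.
  by rewrite -size_poly_eq0 size_XaddC.
rewrite /mq_tgw_t; apply: (fP) => e; rewrite /mq_factor.
case: (incidence e v) => n; apply: fP => i.
  by rewrite /f rmorphD rmorph_nat /= usubst_uvar -polyC_natr XP.
by rewrite /f rmorphB rmorph_nat /= usubst_uvar -polyC_natr -polyCN XP.
Qed.

Definition mq_datum : tgw_datum k V :=
  @TGWDatum k V RE mq_sigma mq_sigmaV mq_sigmaK mq_sigmaVK mq_sigmaC
    mq_tgw_t mq_tgw_t_neq0 (fun v r => mulrC (mq_tgw_t v) r).

Definition mq_mu : tgw_mu k V :=
  @TGWMu k V (fun _ _ => 1) (fun _ _ _ => oner_neq0 k).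

End MultiquiverAlgebra.

(* Main.v *)
Require Import Defs.
From HB Require Import structures.
From mathcomp Require Import all_boot all_algebra.
From mathcomp Require Import finmap all_classical.
From mathcomp.multinomials Require Import monalg.

(** Let [C] be the algebra before the quotient by the radical.  Realizing each
    [u_e] as the Euler operator of a Weyl algebra, [C] maps to the skew group ring
    of [ZV] over [R_E], where a homogeneous element of degree [d] goes to
    [p z^d] with [z^d r = sigma_d(r) z^d]; concretely, [C] acts on functions
    [f : ZV -> R_E] by [(p z^d) f (g) = p sigma_d (f (g - d))].
    The kernel of this map is the radical.  It is graded, and it meets the degree
    zero component in 0 because that component is the image of [R_E], which acts
    faithfully.  Conversely, if a graded ideal meets degree zero trivially and
    contains [x] of degree [d], then [y x = 0] for a product [y] of generators of
    degree [- d], whose symbol is a product of factors [u_e + n] and hence is not a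
    zero divisor; so [x] acts as 0.
    If an element with symbol [sum_d p_d z^d] centralizes [R_E], then
    [p_d gamma_e(d) = 0] for all [e] and [d], where [sigma_d(u_e) = u_e - gamma_e(d)].
    In characteristic zero, [p_d] is nonzero only when [sigma_d] is the identity,
    and such symbols commute with each other.  Maximality follows since the
    centralizer contains the commutative ring [R_E]. *)

Set Implicit Arguments.
Unset Strict Implicit.
Unset Printing Implicit Defensive.

Import GRing.Theory.

Local Open Scope classical_set_scope.
Local Open Scope quotient_scope.
Local Open Scope ring_scope.

(** * Normal forms in [C] and its degree zero component *)

Section DegreeZero.
Variables (k : fieldType) (I : choiceType) (D : tgw_datum k I) (mu : tgw_mu k I).
Local Notation R := (tgw_R D).
Local Notation C := (tgwC D mu).
Local Notation ZI := {malg int[I]}.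
Local Notation homog := (@tgw_homog k I D mu).
Local Notation c := (@tgwC_cst k I D mu).
Local Notation X := (@tgwC_X k I D mu).
Local Notation Y := (@tgwC_Y k I D mu).
Local Notation sigma := (tgw_sigma D).
Local Notation sigmaV := (@tgw_sigmaV _ _ D).
Implicit Types (r s : R) (i j : I) (v w : seq I) (d : ZI) (x y : C).

Lemma tgwC_cst_is_zmod_morphism : zmod_morphism c.
Proof. by move=> r s; rewrite /tgwC_cst !rmorphB. Qed.
Lemma tgwC_cst_is_monoid_morphism : monoid_morphism c.
Proof. by split=> [|r s]; rewrite /tgwC_cst ?rmorph1 ?rmorphM. Qed.

HB.instance Definition _ := GRing.isZmodMorphism.Build R C c
  tgwC_cst_is_zmod_morphism.
HB.instance Definition _ := GRing.isMonoidMorphism.Build R C c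
  tgwC_cst_is_monoid_morphism.

Lemma tgwC_Xr i r : X i * c r = c (sigma i r) * X i.
Proof.
by rewrite /tgwC_X /tgwC_Y /tgwC_cst -!rmorphM; apply/quot_projP/ideal_gen_sub/tgw_rel_Xr.
Qed.

Lemma tgwC_Yr i r : Y i * c r = c (sigmaV i r) * Y i.
Proof.
by rewrite /tgwC_X /tgwC_Y /tgwC_cst -!rmorphM; apply/quot_projP/ideal_gen_sub/tgw_rel_Yr.
Qed.

Lemma tgwC_YX i : Y i * X i = c (tgw_t D i).
Proof. by rewrite /tgwC_X /tgwC_Y -rmorphM; apply/quot_projP/ideal_gen_sub/tgw_rel_YX. Qed.

Lemma tgwC_XY i : X i * Y i = c (sigma i (tgw_t D i)).
Proof. by rewrite /tgwC_X /tgwC_Y -rmorphM; apply/quot_projP/ideal_gen_sub/tgw_rel_XY. Qed.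

Lemma tgwC_XYmu i j : i != j -> X i * Y j = c ((mu i j)%:A) * (Y j * X i).
Proof.
move=> ij; rewrite /tgwC_X /tgwC_Y /tgwC_cst -(rmorphM _ (free_gen _ (GenX i))).
rewrite -(rmorphM _ (free_gen _ (GenY j))) -rmorphM.
by apply/quot_projP/ideal_gen_sub; apply: tgw_rel_mu.
Qed.

Lemma tgwC_YXmu i j : i != j -> Y j * X i = c ((mu i j)^-1%:A) * (X i * Y j).
Proof.
move=> ij; rewrite (tgwC_XYmu ij) [RHS]mulrA -(rmorphM c) -scalerAl mul1r scalerA.
by rewrite mulVf ?mu_neq0 // scale1r rmorph1 mul1r.
Qed.

Definition Xword w : C := \prod_(i <- w) X i.
Definition Yword w : C := \prod_(i <- w) Y i.
Definition word_degree w : ZI := \sum_(i <- w) << i >>.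

Lemma Xword_cst w r : exists s, Xword w * c r = c s * Xword w.
Proof.
elim: w r => [|i w IHw] r; first by exists r; rewrite /Xword big_nil mul1r mulr1.
have [s e] := IHw r; exists (sigma i s); rewrite /Xword big_cons -!/(Xword _).
by rewrite -mulrA e !mulrA tgwC_Xr.
Qed.

Lemma Yword_cst w r : exists s, Yword w * c r = c s * Yword w.
Proof.
elim: w r => [|i w IHw] r; first by exists r; rewrite /Yword big_nil mul1r mulr1.
have [s e] := IHw r; exists (sigmaV i s); rewrite /Yword big_cons -!/(Yword _).
by rewrite -mulrA e !mulrA tgwC_Yr.
Qed.

(** Every letter of [w] differs from [i], so only the [mu] relation is used; the scalars it produces
    are pushed to the left and absorbed in [s]. *)
Lemma Xword_Y w i : i \notin w -> exists s, Xword w * Y i = c s * (Y i * Xword w).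
Proof.
elim: w => [_|j w IHw].
  by exists 1; rewrite /Xword big_nil mul1r mulr1 rmorph1 mul1r.
rewrite inE negb_or eq_sym => /andP[ji /IHw[s e]].
exists (sigma j s * (mu j i)%:A); rewrite /Xword big_cons -!/(Xword _).
by rewrite -mulrA e !mulrA tgwC_Xr -(mulrA _ (X j)) (tgwC_XYmu ji) rmorphM !mulrA.
Qed.

Lemma Y_Xword w i : i \notin w -> exists s, Y i * Xword w = c s * (Xword w * Y i).
Proof.
elim: w => [_|j w IHw].
  by exists 1; rewrite /Xword big_nil mul1r mulr1 rmorph1 mul1r.
rewrite inE negb_or eq_sym => /andP[ji /IHw[s e]].
exists ((mu j i)^-1%:A * sigma j s); rewrite /Xword big_cons -!/(Xword _).
rewrite mulrA (tgwC_YXmu ji) -!mulrA e !mulrA rmorphM; congr (_ * _ * _).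
by rewrite -!mulrA tgwC_Xr.
Qed.

Lemma mem_split_last w i : i \in w ->
  exists w1 w2, w = w1 ++ i :: w2 /\ i \notin w2.
Proof.
elim: w => // j w IHw; rewrite inE.
have [/IHw[w1 [w2 [-> niw2]]] _|niw] := boolP (i \in w).
  by exists (j :: w1), w2.
by rewrite orbF => /eqP <-; exists [::], w.
Qed.

Lemma mem_split_first w i : i \in w ->
  exists w1 w2, w = w1 ++ i :: w2 /\ i \notin w1.
Proof.
elim: w => // j w IHw; rewrite inE.
have [<-|ij /=] := eqVneq i j; first by exists [::], w.
case/IHw => w1 [w2 [-> niw1]]; exists (j :: w1), w2; split=> //.
by rewrite inE negb_or ij.
Qed.

(** The additive span of the words with scalar first, then the [Y]'s, then the [X]'s. The words [v]
    and [w] may share letters, so this describes a spanning set and not a basis. *)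
Inductive normal_form : ZI -> C -> Prop :=
| normal_word r v w :
    normal_form (word_degree w - word_degree v) (c r * Yword v * Xword w)
| normal_zero d : normal_form d 0
| normal_sub d x y : normal_form d x -> normal_form d y -> normal_form d (x - y).

Lemma word_degree_cat v w : word_degree (v ++ w) = word_degree v + word_degree w.
Proof. exact: big_cat. Qed.

Lemma word_degree_cons i w : word_degree (i :: w) = << i >> + word_degree w.
Proof. exact: big_cons. Qed.

Lemma word_degree1 i : word_degree [:: i] = << i >>.
Proof. exact: big_seq1. Qed.

Lemma normal_form_mulr d' y :
    (forall r v w, normal_form (word_degree w - word_degree v + d')
                     (c r * Yword v * Xword w * y)) ->
  forall d x, normal_form d x -> normal_form (d + d') (x * y).
Proof.
move=> Hy d x; elim=> {d x} [r v w|d|d x1 x2 _ IH1 _ IH2].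
- exact: Hy.
- by rewrite mul0r; apply: normal_zero.
- by rewrite mulrBl; apply: normal_sub.
Qed.

Lemma normal_form_cst d x r : normal_form d x -> normal_form d (x * c r).
Proof.
move=> nx; rewrite -[d]addr0; apply: normal_form_mulr nx => s v w.
rewrite addr0 -mulrA; have [r1 ->] := Xword_cst w r.
rewrite mulrA -(mulrA (c s)); have [r2 ->] := Yword_cst v r1.
by rewrite mulrA -(rmorphM c); apply: normal_word.
Qed.

Lemma normal_form_X d x i : normal_form d x -> normal_form (d + << i >>) (x * X i).
Proof.
apply: normal_form_mulr => r v w.
have -> : word_degree w - word_degree v + << i >>
    = word_degree (w ++ [:: i]) - word_degree v.
  by rewrite word_degree_cat word_degree1 addrAC.
have -> : c r * Yword v * Xword w * X i = c r * Yword v * Xword (w ++ [:: i]).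
  by rewrite [Xword (_ ++ _)]big_cat /= big_seq1 mulrA.
exact: normal_word.
Qed.

(** If [i] is not in [w], then [Y i] moves left across the whole word and joins the [Y] part.
    Otherwise it moves left to the last [X i] of [w] and merges with it into a scalar. *)
Lemma normal_form_Y d x i : normal_form d x -> normal_form (d - << i >>) (x * Y i).
Proof.
apply: normal_form_mulr => r v w.
have [iw|niw] := boolP (i \in w); last first.
  have [s e] := Xword_Y niw; rewrite -mulrA e mulrA -(mulrA (c r)).
  have [s' ->] := Yword_cst v s; rewrite !mulrA -(rmorphM c) -(mulrA _ _ (Y i)).
  have -> : Yword v * Y i = Yword (v ++ [:: i]) by rewrite [RHS]big_cat /= big_seq1.
  have -> : word_degree w - word_degree v - << i >>
      = word_degree w - word_degree (v ++ [:: i]).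
    by rewrite word_degree_cat word_degree1 opprD addrA.
  exact: normal_word.
have [w1 [w2 [-> niw2]]] := mem_split_last iw.
have -> : word_degree (w1 ++ i :: w2) - word_degree v - << i >>
    = word_degree (w1 ++ w2) - word_degree v.
  rewrite !word_degree_cat word_degree_cons addrAC; congr (_ - _).
  by rewrite addrCA addrAC subrr add0r.
have [s e] : exists s, Xword (w1 ++ i :: w2) * Y i = c s * Xword (w1 ++ w2).
  rewrite /Xword !big_cat /= big_cons -!/(Xword _) -!mulrA.
  have [s ->] := Xword_Y niw2; rewrite (mulrA (X i)) tgwC_Xr.
  rewrite -!mulrA (mulrA (X i)) tgwC_XY !mulrA -(mulrA (Xword w1)) -(rmorphM c).
  have [s' ->] := Xword_cst w1 (sigma i s * sigma i (tgw_t D i)).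
  by exists s'; rewrite mulrA.
rewrite -mulrA e mulrA -(mulrA (c r)); have [s' ->] := Yword_cst v s.
by rewrite mulrA -(rmorphM c); apply: normal_word.
Qed.

Lemma homog_normal_form d x : homog d x -> normal_form d x.
Proof.
(* Stated as stability under right multiplication, the induction only has to multiply a normal form
   by a generator; products then follow by associativity. *)
suff nf : homog d x -> forall d' y, normal_form d' y -> normal_form (d' + d) (y * x).
  move=> /nf/(_ 0 1); rewrite add0r mul1r; apply.
  have := normal_word 1 [::] [::].
  by rewrite /word_degree /Yword /Xword !big_nil subrr rmorph1 !mulr1.
elim=> {d x} [r|i|i|d|d x y _ IHx _ IHy|d d' x y _ IHx _ IHy] d0 z nz.
- by rewrite addr0; apply: normal_form_cst.
- exact: normal_form_X.
- exact: normal_form_Y.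
- by rewrite mulr0; apply: normal_zero.
- by rewrite mulrBr; apply: normal_sub; [apply: IHx|apply: IHy].
- by rewrite addrA mulrA; apply/IHy/IHx.
Qed.

Lemma mcoeff_word_degree w i : (word_degree w)@_i = (count_mem i w)%:Z.
Proof.
elim: w => [|j w IHw]; first by rewrite /word_degree big_nil mcoeff0.
by rewrite word_degree_cons mcoeffD IHw mcoeffU /= natz PoszD.
Qed.

(** Equal degrees mean equal letter counts, so the last letter [i] of [v] occurs in [w]. Moving
    [Y i] right to the first [X i] turns the pair into [t_i], which shortens both words. *)
Lemma word_of_degree0 r v w : word_degree w = word_degree v ->
  exists s, c r * Yword v * Xword w = c s.
Proof.
elim/last_ind: v r w => [|v i IHv] r w e.
  case: w e => [_|i w e]; first by exists r; rewrite /Yword /Xword !big_nil !mulr1.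
  by have := mcoeff_word_degree (i :: w) i; rewrite e mcoeff_word_degree /= eqxx.
have iw : i \in w.
  rewrite -has_pred1 has_count -ltz_nat -mcoeff_word_degree e mcoeff_word_degree.
  by rewrite ltz_nat -has_count has_pred1 mem_rcons mem_head.
have [w1 [w2 [ew niw1]]] := mem_split_first iw; rewrite {}ew in iw e *.
have e' : word_degree (w1 ++ w2) = word_degree v.
  apply: (addIr << i >>); move: e; rewrite -cats1 !word_degree_cat.
  by rewrite word_degree_cons word_degree1 addrCA addrC.
rewrite -cats1 /Yword /Xword !big_cat /= big_seq1 big_cons -/(Yword _) -!/(Xword _).
have [s es] := Y_Xword niw1.
rewrite -!mulrA (mulrA (Y i)) es -!mulrA (mulrA (Y i)) tgwC_YX.
rewrite (mulrA (Xword w1)); have [s1 ->] := Xword_cst w1 (tgw_t D i).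
rewrite !mulrA -(mulrA _ (c s) (c s1)) -(rmorphM c) -(mulrA (c r)).
have [s2 ->] := Yword_cst v (s * s1).
rewrite mulrA -(rmorphM c) -(mulrA _ (Xword w1)).
have -> : Xword w1 * Xword w2 = Xword (w1 ++ w2) by rewrite /Xword big_cat.
exact: IHv.
Qed.

Lemma homog0_cst x : homog 0 x -> exists r, x = c r.
Proof.
(* The index 0 is replaced by a variable [d] with an equation, so that induction on the normal form
   applies. *)
move=> /homog_normal_form; move: {-2}0 (erefl (0 : ZI)) => d e nx.
elim: nx e => {d x} [r v w|d|d x y _ IHx _ IHy] e.
- by apply: word_of_degree0; apply/eqP; rewrite -subr_eq0 e.
- by exists 0; rewrite rmorph0.
- by have [[r ->] [s ->]] := (IHx e, IHy e); exists (r - s); rewrite rmorphB.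
Qed.

Lemma homogN d x : homog d x -> homog d (- x).
Proof. by rewrite -sub0r; apply/homog_sub/homog_zero. Qed.

Lemma homogD d x y : homog d x -> homog d y -> homog d (x + y).
Proof. by move=> hx hy; rewrite -[y]opprK; apply/homog_sub/homogN. Qed.

Lemma tgwC_homog_sum x : exists2 s : seq (ZI * C),
  {in s, forall p, homog p.1 p.2} & x = \sum_(p <- s) p.2.
Proof.
suff H z : exists2 s : seq (ZI * C),
    {in s, forall p, homog p.1 p.2} & tgwC_proj D mu z = \sum_(p <- s) p.2.
  by move: x; apply: quotW => z; apply: H.
have H1 d y : homog d y -> exists2 s : seq (ZI * C),
    {in s, forall p, homog p.1 p.2} & y = \sum_(p <- s) p.2.
  by move=> hy; exists [:: (d, y)]; rewrite ?big_seq1 // => p /[!inE]/eqP->.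
elim/freeRing_ind: z => [r|[] i|y z [s Hs es] [s' Hs' es']|y [s Hs es]
  |y z [s Hs es] [s' Hs' es']].
- apply: (H1 0); apply: homog_cst.
- apply: (H1 << i >>); apply: homog_X.
- apply: (H1 (- << i >>)); apply: homog_Y.
- exists (s ++ s'); last by rewrite rmorphD es es' big_cat.
  by move=> p; rewrite mem_cat => /orP[/Hs|/Hs'].
- exists [seq (p.1, - p.2) | p <- s]; last by rewrite rmorphN es big_map sumrN.
  by move=> _ /mapP[p /Hs hp ->]; apply: homogN.
- exists [seq (p.1 + q.1, p.2 * q.2) | p <- s, q <- s'].
    by move=> _ /allpairsP[[p q] [/= /Hs hp /Hs' hq ->]]; apply: homog_mul.
  rewrite rmorphM es es' big_allpairs_dep /= mulr_suml; apply: eq_bigr => p _.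
  by rewrite mulr_sumr.
Qed.

(** Homogeneous terms of the same degree are added up. Nothing is said about uniqueness of the
    components. *)
Lemma tgwC_decomposition x : exists (S : seq ZI) (xd : ZI -> C),
  [/\ uniq S, forall d, homog d (xd d) & x = \sum_(d <- S) xd d].
Proof.
have [s Hs ->] := tgwC_homog_sum x.
exists (undup (unzip1 s)), (fun d => \sum_(p <- s | p.1 == d) p.2).
split=> [|d|]; first exact: undup_uniq.
  rewrite big_seq_cond; elim/big_ind: _ => [|y z|p /andP[/Hs hp /eqP <-]] //.
    exact: homog_zero.
  exact: homogD.
rewrite (exchange_big_dep xpredT) //= big_seq [RHS]big_seq; apply: eq_bigr => p ps.
under eq_bigl do rewrite eq_sym.
by rewrite -big_filter filter_pred1_uniq ?big_seq1 ?undup_uniq // mem_undup map_f.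
Qed.

End DegreeZero.

(** * Rising factorials *)

Section RisingFactorial.
Variable R : comNzRingType.
Implicit Types (a : R) (m n : nat).

Definition rising a n : R := \prod_(0 <= i < n) (a + i%:R).

Lemma risingD a m n : rising a (m + n) = rising a m * rising (a + m%:R) n.
Proof.
rewrite /rising (big_cat_nat (leq0n m) (leq_addr n m)) /=; congr (_ * _).
rewrite -{1}[m]add0n big_addn addKn; apply: eq_bigr => i _.
by rewrite natrD addrA addrAC.
Qed.

(** Both sides are the rising factorial of length [m + n]. This identity underlies the commutation
    of [X_v] with [Y_w]. *)
Lemma risingC a m n :
  rising a m * rising (a + m%:R) n = rising a n * rising (a + n%:R) m.
Proof. by rewrite -!risingD addnC. Qed.

Lemma rising_sub a n : rising (a - n%:R) n = \prod_(1 <= i < n.+1) (a - i%:R).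
Proof.
rewrite big_add1 /= [RHS]big_nat_rev /rising !big_nat; apply: eq_bigr => i /andP[_ lt_in].
by rewrite add0n subnSK // natrB ?(ltnW lt_in) // opprB addrA addrAC.
Qed.

End RisingFactorial.

Lemma rmorph_rising (R S : comNzRingType) (f : {rmorphism R -> S}) a n :
  f (rising a n) = rising (f a) n.
Proof. by rewrite rmorph_prod; apply: eq_bigr => i _; rewrite rmorphD rmorph_nat. Qed.

(** * Regular elements of the polynomial ring [R_E] *)

Section Regular.
Variables (k : fieldType) (E : choiceType).
Local Notation RE := (polyE k E).

Lemma mcoeff_uvarM (e : E) (q : RE) (m : {cmonom E}) :
  (uvar k e * q)@_(mmul (ucm e) m) = q@_m.
Proof.
rewrite {1}[q]monalgE mulr_sumr raddf_sum [in RHS](monalgE q) raddf_sum.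
apply: eq_bigr => m' _.
rewrite /uvar malgM_def fgmulUU mul1r /= !mcoeffU; congr (_ *+ _); congr nat_of_bool.
apply/eqP/eqP => [/eqP/cmP em|-> //]; apply/eqP/cmP => i.
by have := em i; rewrite !cmM => /addnI.
Qed.

Lemma mcoeff_uvarDM (e : E) (a : k) (q : RE) (m : {cmonom E}) :
  ((uvar k e + a%:MP) * q)@_(mmul (ucm e) m) = q@_m + a * q@_(mmul (ucm e) m).
Proof.
rewrite mulrDl mcoeffD; congr (_ + _); [exact: mcoeff_uvarM|exact: mcoeffCM].
Qed.

(* If [(u_e + a) q = 0] then [q_m = - a q_(u_e m)], and iterating pushes the
   monomial beyond the degree of [q]. *)
Lemma lreg_uvarD (e : E) (a : k) : GRing.lreg (uvar k e + a%:MP).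
Proof.
apply: mulrI0_lreg => q eq0.
suff q0 n m : (msize q <= mdeg m + n)%N -> q@_m = 0.
  by apply/malgP => m; rewrite mcoeff0 (q0 (msize q)) // leq_addl.
elim: n m => [|n IHn] m; first by rewrite addn0 => /msize_mdeg_ge/mcoeff_outdom.
move=> le_q; have := mcoeff_uvarDM e a q m.
rewrite (IHn (mmul (ucm e) m)); last by rewrite mdegM mdegU add1n addSnnS.
by rewrite mulr0 addr0 => <-; rewrite eq0 mcoeff0.
Qed.

Lemma lreg_prod (R : pzRingType) (T : Type) (s : seq T) (F : T -> R) :
  (forall i, GRing.lreg (F i)) -> GRing.lreg (\prod_(i <- s) F i).
Proof.
move=> regF; elim/big_ind: _ => [|x y|i _]; [exact: lreg1|exact: lregM|exact: regF].
Qed.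

Lemma lreg_rising (e : E) n : GRing.lreg (rising (uvar k e) n).
Proof. by apply: lreg_prod => i; rewrite -mpolyC_nat; apply: lreg_uvarD. Qed.

End Regular.

(** * The automorphisms sigma_d and the factorization of [t_v] *)

Section Realization.
Variables (k : fieldType) (V E : choiceType) (Gamma : multiquiver V E).
Local Notation RE := (polyE k E).
Local Notation ZV := {malg int[V]}.
Local Notation D := (mq_datum k Gamma).
Local Notation mu := (mq_mu k V).
Local Notation u := (uvar k).
Local Notation F := (freeRing RE (tgw_gen V)).
Local Notation C := (tgwC D mu).
Local Notation homog := (@tgw_homog k V D mu).
Local Notation cst := (@tgwC_cst k V D mu).
Implicit Types (d g : ZV) (e : E) (v w : V) (p q r : RE) (f : ZV -> RE).

(** The additive extension gamma_e(d) of row [e] of the incidence matrix. *)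
Definition degree_incidence e : {additive ZV -> int} :=
  mmap idfun (incidence Gamma e).

Lemma degree_incidenceU e v : degree_incidence e << v >> = incidence Gamma e v.
Proof. by rewrite /degree_incidence /= mmapU mul1r. Qed.

Definition sigma d : RE -> RE :=
  usubst (fun e => u e - (degree_incidence e d)%:~R).

HB.instance Definition _ d := GRing.LRMorphism.on (sigma d).

Lemma sigma_uvar d e : sigma d (u e) = u e - (degree_incidence e d)%:~R.
Proof. exact: usubst_uvar. Qed.

Lemma sigma_id d : (forall e, degree_incidence e d = 0) -> sigma d =1 id.
Proof.
move=> d0; apply: (lrmorph_polyE_ext (f := sigma d) (g := idfun)) => e /=.
by rewrite sigma_uvar d0 subr0.
Qed.

Lemma sigma0 : sigma 0 =1 id.
Proof. by apply: sigma_id => e; rewrite raddf0. Qed.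

Lemma sigmaD d d' p : sigma (d + d') p = sigma d (sigma d' p).
Proof.
move: p; apply: (lrmorph_polyE_ext (f := sigma (d + d')) (g := sigma d \o sigma d')).
move=> e /=; rewrite !sigma_uvar rmorphB rmorph_int /= sigma_uvar raddfD.
by rewrite intrD opprD addrA.
Qed.

Lemma sigmaN d : cancel (sigma (- d)) (sigma d).
Proof. by move=> p; rewrite -sigmaD subrr sigma0. Qed.

Lemma sigmaU v : mq_sigma k Gamma v =1 sigma << v >>.
Proof.
apply: (lrmorph_polyE_ext (f := mq_sigma k Gamma v) (g := sigma << v >>)) => e /=.
by rewrite sigma_uvar degree_incidenceU usubst_uvar.
Qed.

Lemma sigmaUN v : mq_sigmaV k Gamma v =1 sigma (- << v >>).
Proof.
apply: (lrmorph_polyE_ext (f := mq_sigmaV k Gamma v) (g := sigma (- << v >>))) => e /=.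
by rewrite sigma_uvar raddfN degree_incidenceU usubst_uvar intrN opprK.
Qed.

Lemma lreg_sigma d p : GRing.lreg p -> GRing.lreg (sigma d p).
Proof.
move=> regp; apply: mulrI0_lreg => y eq0.
have : p * sigma (- d) y = 0.
  by rewrite -[p](sigmaN (- d)) opprK -rmorphM eq0 rmorph0.
by move=> /eqP; rewrite mulrI_eq0 // => /eqP y0; rewrite -[y](sigmaN d) y0 rmorph0.
Qed.

(* Let the Weyl algebra act with [x_e] shifting [u_e] to [u_e - 1] and
   [d_e = u_e x_e^-1].  Then [Xcoef v] and [Ycoef v] are the polynomial parts of
   the products over [e] of [x_e ^ gamma_ev] and [x_e ^ (- gamma_ev)], where
   [x_e ^ (- n)] is read as [d_e ^ n]. *)
Definition Xfactor e v : RE :=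
  if incidence Gamma e v is Negz n then rising (u e) n.+1 else 1.
Definition Yfactor e v : RE :=
  if incidence Gamma e v is Posz n then rising (u e) n else 1.

Definition Xcoef v : RE := \big[*%R/1]_(e \in [set: E]) Xfactor e v.
Definition Ycoef v : RE := \big[*%R/1]_(e \in [set: E]) Yfactor e v.

Lemma incidence_support (s : seq V) : exists A : {fset E},
  forall e v, v \in s -> e \notin A -> incidence Gamma e v = 0.
Proof.
elim: s => [|w s [A HA]]; first by exists fset0.
exists (A `|` fset_set [set e | incidence Gamma e w != 0])%fset => e v.
rewrite in_cons in_fsetU negb_or => /orP[/eqP -> /andP[_]|vs /andP[eA _]]; last exact: HA.
rewrite in_fset_set; last exact: incidence_finite.
by move=> /negP e0; apply/eqP/negPn/negP => ne0; apply: e0; rewrite inE.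
Qed.

Lemma factor_out e v : incidence Gamma e v = 0 ->
  [/\ Xfactor e v = 1, Yfactor e v = 1 & mq_factor k Gamma e v = 1].
Proof.
by rewrite /Xfactor /Yfactor /mq_factor => ->; split=> //=; exact: big_geq.
Qed.

(** One finite set of edges serves all the vertices of [s] and all three products, so identities
    between them can be checked edge by edge. *)
Lemma coef_fset_prod (s : seq V) : exists A : {fset E}, forall v, v \in s ->
  [/\ Xcoef v = \prod_(e <- A) Xfactor e v, Ycoef v = \prod_(e <- A) Yfactor e v
    & mq_tgw_t k Gamma v = \prod_(e <- A) mq_factor k Gamma e v].
Proof.
have [A HA] := incidence_support s; exists A => v vs.
by split; apply: fsbigTE => e /(HA _ _ vs)/factor_out[].
Qed.

(** For gamma_ev = -n, the shift sends [u_e] to u_e - n, and the rising factorial of length n from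
    there is (u_e - 1)...(u_e - n). *)
Lemma factor_t e v :
  Yfactor e v * sigma (- << v >>) (Xfactor e v) = mq_factor k Gamma e v.
Proof.
rewrite /Xfactor /Yfactor /mq_factor.
case ev: (incidence Gamma e v) => [n|n]; first by rewrite rmorph1 mulr1.
rewrite mul1r rmorph_rising /= sigma_uvar raddfN degree_incidenceU ev intrN opprK NegzE.
by rewrite intrN /= rising_sub.
Qed.

Lemma coef_t v : Ycoef v * sigma (- << v >>) (Xcoef v) = mq_tgw_t k Gamma v.
Proof.
have [A /(_ v)[|-> -> ->]] := coef_fset_prod [:: v]; first exact: mem_head.
by rewrite rmorph_prod -big_split; apply: eq_bigr => e _; exact: factor_t.
Qed.

Lemma coef_sigma_t v :
  Xcoef v * sigma << v >> (Ycoef v) = sigma << v >> (mq_tgw_t k Gamma v).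
Proof. by rewrite -coef_t rmorphM /= sigmaN mulrC. Qed.

Lemma incidence_pos e v n : incidence Gamma e v = n.+1%:Z ->
  mq_t Gamma e = Some (v, n.+1).
Proof.
rewrite /incidence /mult_at; case: (mq_t Gamma e) => [[w m]|].
  have [->|_] := eqVneq w v; first by move=> [->].
  by case: (mq_s Gamma e) => [[w' [|m']]|//]; case: eqP.
by case: (mq_s Gamma e) => [[w' [|m']]|//]; case: eqP.
Qed.

Lemma incidence_neg e v n : incidence Gamma e v = Negz n ->
  mq_s Gamma e = Some (v, n.+1).
Proof.
rewrite /incidence /mult_at; case: (mq_t Gamma e) => [[w m]|].
  have [//|_] := eqVneq w v.
  by case: (mq_s Gamma e) => [[w' [|m']]|//]; have [->|] := eqVneq w' v => // -[->].
by case: (mq_s Gamma e) => [[w' [|m']]|//]; have [->|] := eqVneq w' v => // -[->].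
Qed.

(** An edge has at most one source and one target, so its incidences at two distinct vertices cannot
    both be positive or both negative. The substantial case has source [v] and target [w], where the
    claim is [risingC]. *)
Lemma factorC e v w : v != w ->
  Xfactor e v * sigma << v >> (Yfactor e w)
    = Yfactor e w * sigma (- << w >>) (Xfactor e v).
Proof.
move=> vw; rewrite /Xfactor /Yfactor.
case ev: (incidence Gamma e v) => [m|m]; case ew: (incidence Gamma e w) => [n|n].
- rewrite rmorph1 mul1r mulr1; case: n ew => [|n] ew.
    by rewrite /rising big_geq // rmorph1.
  case: m ev => [|m] ev; last first.
    by case/eqP: vw; have := incidence_pos ev; rewrite (incidence_pos ew) => -[->].
  by rewrite rmorph_rising /= sigma_uvar degree_incidenceU ev subr0.
- by rewrite !rmorph1.
- rewrite !rmorph_rising /= !sigma_uvar raddfN !degree_incidenceU ev ew NegzE.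
  by rewrite !intrN !opprK; apply: risingC.
- by case/eqP: vw; have := incidence_neg ev; rewrite (incidence_neg ew) => -[->].
Qed.

Lemma XYcoefC v w : v != w ->
  Xcoef v * sigma << v >> (Ycoef w) = Ycoef w * sigma (- << w >>) (Xcoef v).
Proof.
move=> vw; have [A HA] := coef_fset_prod [:: v; w].
have [-> _ _] := HA v (mem_head _ _).
have wA : w \in [:: v; w] by rewrite !inE eqxx orbT.
have [_ -> _] := HA w wA.
by rewrite !rmorph_prod -!big_split; apply: eq_bigr => e _; apply: factorC.
Qed.

Lemma lreg_Xcoef v : GRing.lreg (Xcoef v).
Proof.
have [A /(_ v (mem_head _ _))[-> _ _]] := coef_fset_prod [:: v]; apply: lreg_prod => e.
by rewrite /Xfactor; case: incidence => n; [apply: lreg1|apply: lreg_rising].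
Qed.

Lemma lreg_Ycoef v : GRing.lreg (Ycoef v).
Proof.
have [A /(_ v (mem_head _ _))[_ -> _]] := coef_fset_prod [:: v]; apply: lreg_prod => e.
by rewrite /Yfactor; case: incidence => n; [apply: lreg_rising|apply: lreg1].
Qed.

(** * The action of the free ring and of [C] on functions from [ZV] to [R_E] *)

Fixpoint term_op (a : rterm RE (tgw_gen V)) (f : ZV -> RE) (g : ZV) : RE :=
  match a with
  | RCst r => r * f g
  | RGen (GenX v) => Xcoef v * sigma << v >> (f (g - << v >>))
  | RGen (GenY v) => Ycoef v * sigma (- << v >>) (f (g + << v >>))
  | RAdd a b => term_op a f g + term_op b f g
  | ROpp a => - term_op a f g
  | RMul a b => term_op a (term_op b f) g
  end.

(** Additivity in the function is what the right distributivity rule of [req] demands of the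
    operators. *)
Lemma term_opD a f f' g :
  term_op a (fun h => f h + f' h) g = term_op a f g + term_op a f' g.
Proof.
elim: a f f' g => [r|[v|v]|a IHa b IHb|a IHa|a IHa b IHb] f f' g /=.
- by rewrite mulrDr.
- by rewrite rmorphD mulrDr.
- by rewrite rmorphD mulrDr.
- by rewrite IHa IHb addrACA.
- by rewrite IHa opprD.
- by rewrite -IHa; congr term_op; apply/funext => h; apply: IHb.
Qed.

Lemma term_op0 a g : term_op a (fun=> 0) g = 0.
Proof.
apply: (addrI (term_op a (fun=> 0) g)); rewrite addr0 -term_opD.
by congr term_op; apply/funext => h; rewrite addr0.
Qed.

Lemma req_term_op a b : req a b -> term_op a = term_op b.
Proof.
have ext (A B : (ZV -> RE) -> ZV -> RE) : (forall f g, A f g = B f g) -> A = B.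
  by move=> AB; apply/funext => f; apply/funext => g; apply: AB.
elim=> {a b}.
- by move=> a.
- by move=> a b _ ->.
- by move=> b a c _ -> _ ->.
- by move=> a a' b b' _ eqa _ eqb; apply: ext => f g; rewrite /= eqa eqb.
- by move=> a a' _ eqa; apply: ext => f g; rewrite /= eqa.
- by move=> a a' b b' _ eqa _ eqb; apply: ext => f g; rewrite /= eqa eqb.
- by move=> a b c; apply: ext => f g; exact: addrA.
- by move=> a b; apply: ext => f g; exact: addrC.
- by move=> a; apply: ext => f g; rewrite /= mul0r add0r.
- by move=> a; apply: ext => f g; rewrite /= mul0r addNr.
- by move=> a b c.
- by move=> a; apply: ext => f g; exact: mul1r.
- move=> a; apply: ext => f g /=; congr (term_op a _ g).
  by apply/funext => h; exact: mul1r.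
- by move=> a b c.
- by move=> a b c; apply: ext => f g; exact: term_opD.
- by move=> r s; apply: ext => f g; exact: mulrDl.
- by move=> r s; apply: ext => f g; rewrite /= mulrA.
Qed.

Definition free_op (x : F) : (ZV -> RE) -> ZV -> RE := term_op (repr x).

Lemma free_op_class a : free_op (free_class a) = term_op a.
Proof. exact/req_term_op/repr_freeP. Qed.

Lemma free_opB x y f g : free_op (x - y) f g = free_op x f g - free_op y f g.
Proof.
move: x y; apply: freeW => a; apply: freeW => b.
by rewrite -[free_class a - _]/(free_add _ (free_opp _)) free_oppE free_addE !free_op_class.
Qed.

Lemma free_opM x y f : free_op (x * y) f = free_op x (free_op y f).
Proof.
move: x y; apply: freeW => a; apply: freeW => b.
by rewrite -[free_class a * _]/(free_mul _ _) free_mulE !free_op_class.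
Qed.

Definition free_op_ker_set (x : F) : Prop := forall f g, free_op x f g = 0.

Program Definition free_op_ker : ideal F := @Ideal F free_op_ker_set _ _ _ _.
Next Obligation. by move=> f g; rewrite free_op_class /= mul0r. Qed.
Next Obligation. by move=> x y x0 y0 f g; rewrite free_opB x0 y0 subr0. Qed.
Next Obligation.
move=> a x x0 f g; rewrite free_opM -[RHS](term_op0 (repr a) g).
by congr term_op; apply/funext => h; apply: x0.
Qed.
Next Obligation. by move=> a x x0 f g; rewrite free_opM x0. Qed.

(** The last relation is [XYcoefC], and the two relations between [X_v] and [Y_v] are the
    factorizations [coef_t] and [coef_sigma_t]. Hence the action descends to [C]. *)
Lemma free_op_rel : tgw_rel (D := D) mu `<=` free_op_ker.
Proof.
have opc r f g : free_op (free_cst _ r) f g = r * f g by rewrite free_op_class.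
have opX v f g : free_op (free_gen _ (GenX v)) f g
  = Xcoef v * sigma << v >> (f (g - << v >>)) by rewrite free_op_class.
have opY v f g : free_op (free_gen _ (GenY v)) f g
  = Ycoef v * sigma (- << v >>) (f (g + << v >>)) by rewrite free_op_class.
move=> _ [] => [v r|v r|v|v|v w vw] f g; rewrite free_opB !free_opM;
    apply/eqP; rewrite subr_eq0; apply/eqP.
- rewrite opX !opc opX rmorphM mulrCA; congr (_ * _); exact/esym/sigmaU.
- rewrite opY !opc opY rmorphM mulrCA; congr (_ * _); exact/esym/sigmaUN.
- rewrite opY opX opc rmorphM /= addrK -sigmaD addNr sigma0 mulrA.
  by congr (_ * _); exact: coef_t.
- rewrite opX opY opc rmorphM /= subrK -sigmaD subrr sigma0 mulrA.
  by congr (_ * _); apply: etrans (coef_sigma_t _) (esym (sigmaU _ _)).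
- rewrite opX opY opc opY opX.
  have -> : (mu v w)%:A = 1 :> RE by exact: scale1r.
  rewrite mul1r (rmorphM (sigma << v >>)) (rmorphM (sigma (- << w >>))) /=.
  by rewrite !mulrA (XYcoefC vw) -!sigmaD [- _ + _]addrC (addrAC g).
Qed.

Definition tgwC_op (x : C) : (ZV -> RE) -> ZV -> RE := free_op (repr x).

Lemma tgwC_op_proj x : tgwC_op (tgwC_proj D mu x) = free_op x.
Proof.
apply/funext => f; apply/funext => g; apply/eqP; rewrite -subr_eq0 -free_opB.
(* Membership in the generated ideal is membership in every ideal containing the relations, here
   instantiated at [free_op_ker]. *)
by apply/eqP; exact: (repr_projP (ideal_gen (tgw_rel (D := D) mu)) x free_op_ker free_op_rel).
Qed.

Lemma tgwC_projW (P : C -> Prop) : (forall z, P (tgwC_proj D mu z)) -> forall x, P x.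
Proof. by move=> Pz; apply: quotW => z; apply: Pz. Qed.

Lemma tgwC_opB x y f g : tgwC_op (x - y) f g = tgwC_op x f g - tgwC_op y f g.
Proof.
move: x y; do 2![apply: tgwC_projW => ?].
rewrite -rmorphB !tgwC_op_proj; exact: free_opB.
Qed.

Lemma tgwC_opM x y f : tgwC_op (x * y) f = tgwC_op x (tgwC_op y f).
Proof.
move: x y; do 2![apply: tgwC_projW => ?].
rewrite -rmorphM !tgwC_op_proj; exact: free_opM.
Qed.

Lemma tgwC_op0 f g : tgwC_op 0 f g = 0.
Proof. by rewrite -[0 in LHS](subrr 0) tgwC_opB subrr. Qed.

Lemma tgwC_opD x y f g : tgwC_op (x + y) f g = tgwC_op x f g + tgwC_op y f g.
Proof. by rewrite -[y in LHS]opprK -(sub0r y) !tgwC_opB tgwC_op0 sub0r opprK. Qed.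

Lemma tgwC_op_sum (T : Type) (s : seq T) (x : T -> C) f g :
  tgwC_op (\sum_(i <- s) x i) f g = \sum_(i <- s) tgwC_op (x i) f g.
Proof.
apply: (big_morph (fun x => tgwC_op x f g)) => [x1 x2|]; first exact: tgwC_opD.
exact: tgwC_op0.
Qed.

Lemma tgwC_op_cst r f g : tgwC_op (cst r) f g = r * f g.
Proof. by rewrite tgwC_op_proj free_op_class. Qed.

Lemma tgwC_op_X v f g :
  tgwC_op (tgwC_X D mu v) f g = Xcoef v * sigma << v >> (f (g - << v >>)).
Proof. by rewrite tgwC_op_proj free_op_class. Qed.

Lemma tgwC_op_Y v f g :
  tgwC_op (tgwC_Y D mu v) f g = Ycoef v * sigma (- << v >>) (f (g + << v >>)).
Proof. by rewrite tgwC_op_proj free_op_class. Qed.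

(** * Symbols p z^d of homogeneous elements *)

Definition acts_by d (x : C) (p : RE) : Prop :=
  forall f g, tgwC_op x f g = p * sigma d (f (g - d)).

Lemma acts_by_cst r : acts_by 0 (cst r) r.
Proof. by move=> f g; rewrite tgwC_op_cst subr0 sigma0. Qed.

Lemma acts_by_X v : acts_by << v >> (tgwC_X D mu v) (Xcoef v).
Proof. exact: tgwC_op_X. Qed.

Lemma acts_by_Y v : acts_by (- << v >>) (tgwC_Y D mu v) (Ycoef v).
Proof. by move=> f g; rewrite tgwC_op_Y opprK. Qed.

Lemma acts_byM d d' x y p q : acts_by d x p -> acts_by d' y q ->
  acts_by (d + d') (x * y) (p * sigma d q).
Proof.
by move=> xp yq f g; rewrite tgwC_opM xp yq rmorphM mulrA sigmaD opprD addrA.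
Qed.

Lemma homog_acts_by d x : homog d x -> exists p, acts_by d x p.
Proof.
elim=> {d x} [r|v|v|d|d x y _ [p xp] _ [q yq]|d d' x y _ [p xp] _ [q yq]].
- by exists r; apply: acts_by_cst.
- by exists (Xcoef v); apply: acts_by_X.
- by exists (Ycoef v); apply: acts_by_Y.
- by exists 0 => f g; rewrite tgwC_op0 mul0r.
- by exists (p - q) => f g; rewrite tgwC_opB xp yq mulrBl.
- by exists (p * sigma d q); apply: acts_byM.
Qed.

(** A product of generators, with [X_v] or [Y_v] chosen by the sign of the coefficient of [v] in
    [d]. Its symbol is a product of shifted regular coefficients. *)
Lemma regular_of_degree d :
  exists z p, [/\ homog d z, acts_by d z p & GRing.lreg p].
Proof.
pose reg d := exists z p, [/\ homog d z, acts_by d z p & GRing.lreg p].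
have reg0 : reg 0.
  exists (cst 1), 1.
  by split; [exact: homog_cst|exact: acts_by_cst|exact: lreg1].
have regD a b : reg a -> reg b -> reg (a + b).
  move=> [x [p [hx xp rp]]] [y [q [hy yq rq]]]; exists (x * y), (p * sigma a q).
  by split; [apply: homog_mul|apply: acts_byM|apply/lregM/lreg_sigma].
have regMn a n : reg a -> reg (a *+ n).
  by move=> ra; elim: n => [|n IHn]; [exact: reg0|rewrite mulrS; exact: regD].
suff regU v n : reg << n *g v >>.
  have : reg (\sum_(v <- msupp d) << d@_v *g v >>).
    by apply: (big_ind reg reg0 regD) => v _; exact: regU.
  by rewrite -(monalgE d).
have -> : << n *g v >> =
    (if n is Negz m then - << v >> *+ m.+1 else << v >> *+ `|n|) :> ZV.
  case: n => n; first by rewrite -monalgUMn natz.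
  by rewrite NegzE monalgUN mulNrn -monalgUMn natz.
case: n => n; apply: regMn.
  exists (tgwC_X D mu v), (Xcoef v).
  by split; [exact: homog_X|exact: acts_by_X|exact: lreg_Xcoef].
exists (tgwC_Y D mu v), (Ycoef v).
by split; [exact: homog_Y|exact: acts_by_Y|exact: lreg_Ycoef].
Qed.

(** A test function: an operator with symbol sum_d p_d z^d, applied to it and evaluated at [g],
    returns the coefficient p_g. *)
Definition delta0 (g : ZV) : RE := (g == 0)%:R.

Lemma acts_by_delta0 d x p : acts_by d x p -> tgwC_op x delta0 d = p.
Proof. by move=> ->; rewrite /delta0 subrr eqxx rmorph1 mulr1. Qed.

Lemma sum_delta0 (S : seq ZV) (p : ZV -> RE) g : uniq S -> g \in S ->
  \sum_(d <- S) p d * sigma d (delta0 (g - d)) = p g.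
Proof.
move=> uS gS; rewrite (bigD1_seq g) //= /delta0 subrr eqxx rmorph1 mulr1.
rewrite big1 ?addr0 // => d dg.
by rewrite subr_eq0 eq_sym (negPf dg) rmorph0 mulr0.
Qed.

Lemma tgwC_op_decomposition x : exists (S : seq ZV) (xd : ZV -> C) (p : ZV -> RE),
  [/\ uniq S, forall d, homog d (xd d), x = \sum_(d <- S) xd d
    & forall d, acts_by d (xd d) (p d)].
Proof.
have [S [xd [uS hxd ->]]] := tgwC_decomposition x.
have [p Hp] := choice (fun d => homog_acts_by (hxd d)).
by exists S, xd, p.
Qed.

(** * The radical as the kernel of the action *)

Definition tgwC_op_ker_set (x : C) : Prop := forall f g, tgwC_op x f g = 0.

Program Definition tgwC_op_ker : ideal C := @Ideal C tgwC_op_ker_set _ _ _ _.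
Next Obligation. by move=> f g; apply: tgwC_op0. Qed.
Next Obligation. by move=> x y x0 y0 f g; rewrite tgwC_opB x0 y0 subr0. Qed.
Next Obligation.
(* The operator of [a] is [term_op] of a representative in the free ring, itself represented by a
   term; hence the two [repr]. *)
move=> a x x0 f g; rewrite tgwC_opM -[RHS](term_op0 (repr (repr a)) g).
by congr term_op; apply/funext => h; apply: x0.
Qed.
Next Obligation. by move=> a x x0 f g; rewrite tgwC_opM x0. Qed.

Lemma tgwC_op_ker_graded : graded_ideal tgwC_op_ker.
Proof.
move=> x; have [S [xd [p [uS hxd -> xdp]]]] := tgwC_op_decomposition x => x0.
exists [seq xd d | d <- S]; last by rewrite big_map.
move=> _ /mapP[d dS ->]; split; last by exists d.
suff pd0 : p d = 0 by move=> f g; rewrite xdp pd0 mul0r.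
have := x0 delta0 d; rewrite tgwC_op_sum.
under eq_bigr do rewrite xdp.
by rewrite sum_delta0.
Qed.

Lemma tgwC_op_ker_degree0 : zero_meets_degree0 tgwC_op_ker.
Proof.
move=> x x0 /homog0_cst[r ex]; move: x0; rewrite ex => /(_ delta0 0).
by rewrite (acts_by_delta0 (acts_by_cst r)) => ->; rewrite rmorph0.
Qed.

(* A homogeneous element of degree [d] in an ideal meeting degree 0 trivially is
   killed by every element of degree [- d]; one of these acts regularly. *)
Lemma tgw_radicalE x : tgw_radical D mu x <-> tgwC_op_ker x.
Proof.
split=> [[s Hs ->]|x0]; last first.
  exists [:: x]; rewrite ?big_seq1 // => y; rewrite mem_seq1 => /eqP ->.
  exists tgwC_op_ker => //.
  by split; [apply: tgwC_op_ker_graded|apply: tgwC_op_ker_degree0].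
rewrite big_seq; elim/big_ind: _ => [|y z|y /Hs[J [grJ J0] Jy]].
- exact: (ideal0 tgwC_op_ker).
- exact: (@idealD _ tgwC_op_ker).
have {y Jy} [t Ht ->] := grJ y Jy.
rewrite big_seq; elim/big_ind: _ => [|y z|y /Ht[Jy [d hy]]].
- exact: (ideal0 tgwC_op_ker).
- exact: (@idealD _ tgwC_op_ker).
have [p yp] := homog_acts_by hy.
have [z [q [hz zq rq]]] := regular_of_degree (- d).
have zy0 : z * y = 0.
  apply: J0; first exact: idealMl.
  by rewrite -[0](addNr d); apply: homog_mul.
(* The symbol of [z * y] is [q * sigma (- d) p]; it vanishes, and [q] can be cancelled. *)
have := acts_by_delta0 (acts_byM zq yp); rewrite zy0 tgwC_op0 => /esym/eqP.
rewrite mulrI_eq0 // => /eqP p0 f g.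
by rewrite yp -[p](sigmaN d) p0 rmorph0 mul0r.
Qed.

(** * Faithfulness of the action of [A], and the centralizer of [R_E] *)

Lemma tgwA_projW (P : tgwA D mu -> Prop) :
  (forall x, P (tgwA_proj D mu x)) -> forall a, P a.
Proof. by move=> Px; apply: quotW => x; apply: Px. Qed.

Lemma tgwA_projP x y :
  tgwA_proj D mu x = tgwA_proj D mu y <-> forall f g, tgwC_op x f g = tgwC_op y f g.
Proof.
split=> [/quot_projP/tgw_radicalE xy f g|xy].
  by apply/eqP; rewrite -subr_eq0 -tgwC_opB xy.
by apply/quot_projP/tgw_radicalE => f g; rewrite tgwC_opB xy subrr.
Qed.

(** The conclusion has no sigma_d: each degree with a nonzero coefficient acts trivially on [R_E],
    and the other terms vanish anyway. *)
Lemma lift_centralizer (chark : [pchar k] =i pred0) x :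
    tgw_centralizer D mu (tgwA_proj D mu x) ->
  exists (S : seq ZV) (p : ZV -> RE),
    forall f g, tgwC_op x f g = \sum_(d <- S) p d * f (g - d).
Proof.
move=> Cx; have [S [xd [p [uS hxd ex xdp]]]] := tgwC_op_decomposition x.
have opx f g : tgwC_op x f g = \sum_(d <- S) p d * sigma d (f (g - d)).
  by rewrite ex tgwC_op_sum; apply: eq_bigr => d _; apply: xdp.
exists S, p => f g; rewrite opx; apply: eq_big_seq => d dS.
have [->|p0] := eqVneq (p d) 0; first by rewrite !mul0r.
rewrite sigma_id // => e.
(* Testing on [delta0] at [d] isolates the coefficients of degree [d] and yields p_d (u_e -
   gamma_e(d)) = u_e p_d. *)
have /tgwA_projP/(_ delta0 d) : tgwA_proj D mu (x * cst (uvar k e))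
    = tgwA_proj D mu (cst (uvar k e) * x).
  by rewrite !rmorphM; apply: Cx.
rewrite !tgwC_opM tgwC_op_cst (opx delta0 d) (sum_delta0 p uS dS) (opx _ d).
have -> : \sum_(i <- S) p i * sigma i (tgwC_op (cst (uvar k e)) delta0 (d - i))
    = p d * sigma d (uvar k e).
  rewrite -(sum_delta0 (fun i => p i * sigma i (uvar k e)) uS dS).
  by apply: eq_bigr => i _; rewrite tgwC_op_cst rmorphM mulrA.
rewrite sigma_uvar mulrBr.
rewrite (mulrC (uvar k e)) => /eqP; rewrite -subr_eq0 addrAC subrr sub0r oppr_eq0.
rewrite mulrzr -scaler_int scaler_eq0 (negPf p0) orbF.
(* Characteristic zero turns the vanishing of gamma_e(d) in [k] into its vanishing as an integer. *)
have nat0 := (pcharf0P _).1 chark.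
case: (degree_incidence e d) => n; last first.
  by rewrite NegzE intrN oppr_eq0 nat0.
by rewrite nat0 => /eqP ->.
Qed.

(** Without twists, both products act as the double sum of p_d q_d' f(g - d - d'), up to the order
    of summation. *)
Lemma centralizer_commutative : [pchar k] =i pred0 ->
  is_commutative (tgw_centralizer D mu).
Proof.
move=> chark; apply: tgwA_projW => x; apply: tgwA_projW => y Cx Cy.
rewrite -!rmorphM; apply/tgwA_projP => f g.
have [S [p xp]] := lift_centralizer chark Cx.
have [T [q yq]] := lift_centralizer chark Cy.
rewrite !tgwC_opM xp yq.
under eq_bigr do rewrite yq mulr_sumr.
under [RHS]eq_bigr do rewrite xp mulr_sumr.
rewrite exchange_big; apply: eq_bigr => d _; apply: eq_bigr => d' _.
by rewrite mulrCA addrAC.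
Qed.

End Realization.

(** * Maximality of a commutative centralizer *)

Section Maximal.
Variables (k : fieldType) (I : choiceType) (D : tgw_datum k I) (mu : tgw_mu k I).
Local Notation Z := (tgw_centralizer D mu).

Lemma centralizer_is_subalgebra : is_subalgebra Z.
Proof.
split=> [r|a x Zx r|x y Zx Zy r|x y Zx Zy r]; first by rewrite mul1r mulr1.
- by rewrite -tgw_scaleAl Zx tgw_scaleAr.
- by rewrite mulrDl mulrDr Zx Zy.
- by rewrite -mulrA Zy mulrA Zx mulrA.
Qed.

Lemma commutative_centralizer_maximal :
    (forall r s : tgw_R D, r * s = s * r) -> is_commutative Z ->
  maximal_commutative_subalgebra Z.
Proof.
move=> RC ZC; split=> // [|B' _ B'C ZB']; first exact: centralizer_is_subalgebra.
(* As [R] is commutative, its image lies in the centralizer, hence in [B']; so each element of [B']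
   commutes with it. *)
apply/seteqP; split=> // x B'x r; apply: B'C => //; apply: ZB' => s.
by rewrite -!rmorphM RC.
Qed.

End Maximal.

Theorem corollary4p9 (k : fieldType) (chark : [pchar k]%R =i pred0)
    (V E : choiceType) (Gamma : multiquiver V E) :
  maximal_commutative_subalgebra
    (tgw_centralizer (mq_datum k Gamma) (mq_mu k V)).
Proof.
apply: commutative_centralizer_maximal; first exact: mulrC.
exact: centralizer_commutative.
Qed.
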